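(* Let $X$ be a function space in the wide sense on $(\Omega,\Sigma,\mu,\Delta_X)$ and let $Y$ be a nonzero Banach space. Then the space $K(X,Y)$ of compact operators from $X$ to $Y$ is absolutely continuous (every $T\in K(X,Y)$ is absolutely continuous) if and only if $X^*$ is absolutely continuous.
   Context: All Banach spaces are complex; $(\Omega,\Sigma,\mu)$ is a measure space. A Banach space $X$ is a function space in the wide sense on $(\Omega,\Sigma,\mu,\Delta_X)$ if $\Delta_X:\Sigma\times X\to X$ satisfies: (I) $\Delta_X(A\cap B,f)=\Delta_X(A,\Delta_X(B,f))$ for all $A,B\in\Sigma$, $f\in X$; (II) $f\mapsto\Delta_X(A,f)$ is linear for each $A\in\Sigma$; (III) $\Delta_X(A\cup B,f)=\Delta_X(A,f)+\Delta_X(B,f)$ if $A\cap B=\emptyset$; (IV) $\Delta_X(A,f)=0$ if $\mu(A)=0$, and $\Delta_X(\Omega,f)=f$; (V) there is $C>0$ with $\|\Delta_X(A,f)\|\le C\|f\|$ for all $A,f$. A bounded operator $T:X\to Y$ is absolutely continuous if for every $\varepsilon>0$ there is $\delta>0$ such that for every $A\in\Sigma$ with $\mu(A)<\delta$, the operator $f\mapsto T(\Delta_X(A,f))$ has norm $<\varepsilon$ in $\mathcal L(X,Y)$. The dual $X^*$ is a function space in the wide sense with $\Delta_{X^*}^*$ defined by $\langle f,\Delta_{X^*}^*(A,f^* )\rangle=\langle\Delta_X(A,f),f^*\rangle$. $X^*$ is absolutely continuous if for every $f^*\in X^*$ and every $\varepsilon>0$ there is $\delta>0$ such that $\|\Delta_{X^*}^*(A,f^*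 )\|_{X^*}<\varepsilon$ whenever $A\in\Sigma$ and $\mu(A)<\delta$. *)

(* Defs.v *)
(* A complex Banach space is a completeNormedModType over
   R[i], for R : realType.  The library norm `|x| takes its values in R[i] (it
   is a nonnegative real there), hence the projections complex.Re below. *)
From HB Require Import structures.
From mathcomp Require Import all_boot all_order all_algebra.
From mathcomp Require Import complex.
From mathcomp Require Import all_classical all_reals all_analysis.

Set Implicit Arguments.
Unset Strict Implicit.
Unset Printing Implicit Defensive.
Import Order.TTheory GRing.Theory Num.Theory.
Import numFieldNormedType.Exports.
Local Open Scope classical_set_scope.
Local Open Scope ring_scope.
Local Open Scope complex_scope.

(* Delta is a total function on set T, but it is constrained and used only on
   measurable sets, so that it represents a map Sigma x X -> X. *)
Record wide_function_space (R : realType) (d : measure_display)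
    (T : measurableType d) (mu : {measure set T -> \bar R})
    (X : completeNormedModType R[i]) (Delta : set T -> X -> X) : Prop :=
  WideFunctionSpace {
    wfs_setI : forall A B f, measurable A -> measurable B ->
      Delta (A `&` B) f = Delta A (Delta B f) ;
    wfs_linear : forall A, measurable A -> linear (Delta A) ;
    wfs_setU : forall A B f, measurable A -> measurable B ->
      A `&` B = set0 -> Delta (A `|` B) f = Delta A f + Delta B f ;
    wfs_null : forall A f, measurable A -> mu A = 0%E -> Delta A f = 0 ;
    wfs_setT : forall f, Delta setT f = f ;
    wfs_bounded : exists C : R, 0 < C /\
      forall A f, measurable A -> `|Delta A f| <= C%:C * `|f| }.

Section operators.
Variables (R : realType) (X Y : normedModType R[i]).

(* Operator norm, as an extended real; it is finite exactly when the linear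
   map f is bounded. *)
Definition opnorm (f : X -> Y) : \bar R :=
  ereal_sup [set (complex.Re `|f x|)%:E | x in [set x : X | `|x| <= 1]].

Definition bounded_operators : set {linear X -> Y} :=
  [set S : {linear X -> Y} | continuous S].

Definition compact_operators : set {linear X -> Y} :=
  [set S : {linear X -> Y} |
    bounded_operators S /\ precompact [set S x | x in [set x : X | `|x| <= 1]]].

End operators.
Arguments bounded_operators {R} X Y.
Arguments compact_operators {R} X Y.

(* Continuous linear functionals; R[i]^o is R[i] as a normed space over
   itself. *)
Definition dual (R : realType) (X : normedModType R[i]) :
  set {linear X -> R[i]^o} := bounded_operators X R[i]^o.
Arguments dual {R} X.

Section absolute_continuity.
Variables (R : realType) (d : measure_display) (T : measurableType d).
Variables (mu : {measure set T -> \bar R}) (X : completeNormedModType R[i]).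
Variable Delta : set T -> X -> X.

Definition absolutely_continuous_operator (Y : completeNormedModType R[i])
    (S : {linear X -> Y}) : Prop :=
  forall e : R, 0 < e -> exists2 delta : R, 0 < delta &
    forall A, measurable A -> (mu A < delta%:E)%E ->
      (opnorm (fun f => S (Delta A f)) < e%:E)%E.

Definition dual_Delta (A : set T) (fs : {linear X -> R[i]^o}) : X -> R[i]^o :=
  fun f => fs (Delta A f).

Lemma dual_Delta_linear A fs : wide_function_space mu Delta ->
  measurable A -> linear (dual_Delta A fs).
Proof.
by move=> H mA a x y; rewrite /dual_Delta (wfs_linear H mA) linearP.
Qed.

Lemma dual_Delta_continuous A fs : wide_function_space mu Delta ->
  measurable A -> dual X fs -> continuous (dual_Delta A fs).
Proof.
move=> H mA cfs x; apply: continuous_comp; last exact: cfs.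
pose D : {linear X -> X} :=
  HB.pack (Delta A) (GRing.isLinear.Build _ _ _ _ _ (wfs_linear H mA)).
apply: (@bounded_linear_continuous _ _ _ D).
apply/bounded_funP => r; have [C [C0 DC]] := wfs_bounded H.
exists (C%:C * r) => y yr; apply: le_trans (DC A y mA) _.
by rewrite ler_wpM2l// lecR ltW.
Qed.

Definition dual_absolutely_continuous : Prop :=
  forall fs, dual X fs ->
  forall e : R, 0 < e -> exists2 delta : R, 0 < delta &
    forall A, measurable A -> (mu A < delta%:E)%E ->
      (opnorm (dual_Delta A fs) < e%:E)%E.

End absolute_continuity.

(* Main.v *)
(** If every compact operator is absolutely continuous, so are the rank-one
    operators [f |-> <f, fs> y] with [y != 0], and the norm of such an operator
    is the norm of [fs] times that of [y].

    Conversely, suppose that [S] is compact but not absolutely continuous.  Then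
    there are [A_n] with [mu A_n -> 0] and [f_n] in the unit ball such that
    [S (Delta A_n f_n)] stays away from [0]; by compactness these vectors have a
    cluster point [p != 0].  Hahn-Banach gives a functional [F] with
    [F p != 0], but [F \o S] lies in the absolutely continuous dual of [X], hence
    [F (S (Delta A_n f_n)) -> 0], a contradiction. *)
Require Import Defs.
From HB Require Import structures.
From mathcomp Require Import all_boot all_order all_algebra.
From mathcomp Require Import complex.
From mathcomp Require Import all_classical all_reals all_analysis.
From mathcomp Require Import ring lra.
Set Implicit Arguments.
Unset Strict Implicit.
Unset Printing Implicit Defensive.
Import Order.TTheory GRing.Theory Num.Theory.
Import numFieldNormedType.Exports.
Local Open Scope classical_set_scope.
Local Open Scope ring_scope.
Local Open Scope complex_scope.

(** * Hahn-Banach for real sublinear functionals, by minimality *)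

Section sublinear.
Variables (R : realType) (V : lmodType R[i]).
Implicit Types (p q : V -> R) (x y z : V).

(** Homogeneity is asked only as an inequality, which passes easily to infima; applying it to [r^-1]
    as well gives back the equality. *)
Definition sublinear p :=
  (forall x y, p (x + y) <= p x + p y) /\
  (forall (r : R) x, 0 < r -> p (r%:C *: x) <= r * p x).

Lemma sublinear0 p : sublinear p -> 0 <= p 0.
Proof. by case=> /(_ 0 0); rewrite addr0; lra. Qed.

Lemma sublinear_geN p x : sublinear p -> - p (- x) <= p x.
Proof.
move=> sp; have := sublinear0 sp; case: sp => /(_ x (- x)) + _.
by rewrite subrr; lra.
Qed.

Lemma sublinearZ p (r : R) x : sublinear p -> 0 < r ->
  p (r%:C *: x) = r * p x.
Proof.
move=> -[_ pZ] r0; apply/eqP; rewrite eq_le pZ//=.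
have := pZ r^-1 (r%:C *: x); rewrite invr_gt0 => /(_ r0).
by rewrite scalerA -rmorphM/= mulVf ?gt_eqF// scale1r ler_pdivlMl.
Qed.

(* Lowers [p] so that its value at [- z] is at most [p 0 - p z], whence every
   additive minorant of it takes a value at least [p z - p 0] at [z]. *)
Definition shift p z x : R :=
  inf [set p (x + t%:C *: z) - t * p z | t in [set t : R | 0 <= t]].

(** Subadditivity at [x + t z] and [- x] bounds [t * p z] by [p (x + t z) + p (- x)]. *)
Lemma shift_has_lbound p z x : sublinear p ->
  has_lbound [set p (x + t%:C *: z) - t * p z | t in [set t : R | 0 <= t]].
Proof.
move=> sp; exists (- p (- x)) => _ [t /= t0 <-].
have := sp.1 (x + t%:C *: z) (- x); rewrite addrAC subrr add0r.
have [->|tN0] := eqVneq t 0.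
  by rewrite scale0r; have := sublinear0 sp; lra.
by rewrite sublinearZ ?lt_neqAle 1?eq_sym ?tN0//; lra.
Qed.

Lemma shift_le p z x (t : R) : sublinear p -> 0 <= t ->
  shift p z x <= p (x + t%:C *: z) - t * p z.
Proof. by move=> sp t0; apply: ge_inf; [exact: shift_has_lbound|exists t]. Qed.

Lemma le_shift p z x (a : R) :
  (forall t : R, 0 <= t -> a <= p (x + t%:C *: z) - t * p z) -> a <= shift p z x.
Proof.
move=> h; apply: lb_le_inf; last by move=> _ [t /= /h ? <-].
by exists (p (x + 0%:C *: z) - 0 * p z), 0 => /=.
Qed.

(** Parameters [s] for [x] and [t] for [y] combine to [s + t] for [x + y], and [t] for [x] becomes
    [r * t] for [r x]. *)
Lemma shift_sublinear p z : sublinear p -> sublinear (shift p z).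
Proof.
move=> sp; split=> [x y|r x r0].
  rewrite -lerBlDr; apply: le_shift => s s0.
  rewrite lerBlDl -lerBlDr; apply: le_shift => t t0.
  have := shift_le z (x + y) sp (addr_ge0 s0 t0).
  have := sp.1 (x + s%:C *: z) (y + t%:C *: z).
  by rewrite addrACA -scalerDl -rmorphD/=; lra.
rewrite -ler_pdivrMl//; apply: le_shift => t t0.
have := shift_le z (r%:C *: x) sp (mulr_ge0 (ltW r0) t0).
rewrite rmorphM/= -scalerA -scalerDr (sublinearZ _ sp r0) => h.
by rewrite ler_pdivrMl// mulrBr mulrA.
Qed.

Lemma shift_le_id p z x : sublinear p -> shift p z x <= p x.
Proof.
by move=> /(shift_le z x) /(_ (lexx 0)); rewrite scale0r addr0 mul0r subr0.
Qed.

Lemma shift_le_subr p z x : sublinear p -> shift p z x <= p (x + z) - p z.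
Proof. by move=> /(shift_le z x) /(_ ler01); rewrite scale1r mul1r. Qed.

(** Zorn's lemma for the reversed pointwise order on the sublinear functionals below [p]. The
    pointwise infimum of a nonempty chain bounds it, and is finite because each member is at least
    [- p (- x)] at [x]. *)
Lemma minimal_sublinear p : sublinear p ->
  exists q, [/\ sublinear q, (forall x, q x <= p x) &
    forall q', sublinear q' -> (forall x, q' x <= q x) -> q' = q].
Proof.
move=> sp; pose W := {q : V -> R | sublinear q /\ forall x, q x <= p x}.
pose rel_ge (u v : W) : bool := `[< forall x, sval v x <= sval u x >].
have [| | |A Atot|[q [sq qp]] qmin] := @Zorn W rel_ge.
- by move=> t; apply/asboolP.
- move=> r s t /asboolP rs /asboolP st; apply/asboolP => x.
  exact: le_trans (st x) (rs x).
- move=> s t /asboolP st /asboolP ts; apply: eq_sig_hprop => [?|]; first exact: Prop_irrelevance.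
  by apply/funext => x; apply/le_anti; rewrite st ts.
- have [[u0 Au0]|A0] := pselect (exists u, A u); last first.
    by exists (exist _ p (conj sp (fun=> lexx _))) => s As; case: A0; exists s.
  pose m x := inf [set sval u x | u in A].
  have lbA x : has_lbound [set sval u x | u in A].
    exists (- p (- x)) => _ [[u [su up]] Au <-] /=.
    by apply: le_trans (sublinear_geN x su); rewrite lerN2.
  have m_le x u : A u -> m x <= sval u x.
    by move=> Au; apply: ge_inf => //; exists u.
  have le_m x a : (forall u, A u -> a <= sval u x) -> a <= m x.
    move=> h; apply: lb_le_inf; first by exists (sval u0 x), u0.
    by move=> _ [u /h ? <-].
  have sm : sublinear m.
    split=> [x y|r x r0].
      rewrite -lerBlDr; apply: (le_m) => u Au.
      rewrite lerBlDl -lerBlDr; apply: (le_m) => v Av.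
      rewrite lerBlDr.
      (* The smaller of [u] and [v] serves for both summands. *)
      have [/asboolP vu|/asboolP uv] := Atot _ _ Au Av.
        apply: le_trans (m_le _ _ Av) _.
        apply: le_trans ((svalP v).1.1 x y) _.
        by rewrite addrC lerD2l.
      apply: le_trans (m_le _ _ Au) _.
      apply: le_trans ((svalP u).1.1 x y) _.
      by rewrite addrC lerD2r.
    rewrite -ler_pdivrMl//; apply: (le_m) => u Au.
    rewrite ler_pdivrMl//.
    exact: le_trans (m_le _ _ Au) ((svalP u).1.2 r x r0).
  have mp x : m x <= p x := le_trans (m_le x u0 Au0) ((svalP u0).2 x).
  exists (exist _ m (conj sm mp)) => s As; apply/asboolP => x /=.
  exact: m_le.
- exists q; split=> // q' sq' q'q.
  have q'p x : q' x <= p x := le_trans (q'q x) (qp x).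
  have := qmin (exist _ q' (conj sq' q'p)).
  by move=> /(_ (asboolT q'q)) [].
Qed.

(* Hahn-Banach: a minimal sublinear functional coincides with all its shifts,
   which makes it superadditive. *)
Lemma sublinear_minorant p : sublinear p ->
  exists q : V -> R, [/\ (forall x y, q (x + y) = q x + q y),
    (forall (r : R) x, q (r%:C *: x) = r * q x) & forall x, q x <= p x].
Proof.
move=> /minimal_sublinear[q [sq qp qmin]]; exists q.
have qD x y : q (x + y) = q x + q y.
  apply/le_anti; rewrite sq.1/=.
  have := shift_le_subr y x sq.
  rewrite (qmin _ (shift_sublinear y sq) (fun x => shift_le_id y x sq)); lra.
have q0 : q 0 = 0 by have := qD 0 0; rewrite addr0; lra.
have qN x : q (- x) = - q x by have := qD x (- x); rewrite subrr q0; lra.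
split=> // r x; have [r0|r0|->] := ltgtP r 0; last by rewrite scale0r mul0r.
- have := sublinearZ (- x) sq (_ : 0 < - r); rewrite oppr_gt0 => /(_ r0).
  by rewrite rmorphN/= scaleNr scalerN opprK qN mulrNN.
- exact: sublinearZ.
Qed.

End sublinear.

(** * The real-valued norm, and continuous functionals separating points from 0 *)

Section real_norm.
Variables (R : realType) (V : normedModType R[i]).
Implicit Types x y : V.

Lemma Re_normK x : (complex.Re `|x|)%:C = `|x|.
Proof. exact/RRe_real/normr_real. Qed.

Lemma Re_norm_ge0 x : 0 <= complex.Re `|x|.
Proof. by rewrite -ler0c Re_normK. Qed.

Lemma Re_norm_gt0 x : (0 < complex.Re `|x|) = (x != 0).
Proof. by rewrite -ltcR Re_normK normr_gt0. Qed.

Lemma Re_normZ (c : R[i]) x :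
  complex.Re `|c *: x| = complex.Re `|c| * complex.Re `|x|.
Proof. by apply: complexI; rewrite rmorphM/= !Re_normK normrZ. Qed.

Lemma Re_normD x y : complex.Re `|x + y| <= complex.Re `|x| + complex.Re `|y|.
Proof. by rewrite -lecR rmorphD/= !Re_normK ler_normD. Qed.

Lemma normcR (r : R) : `|r%:C| = `|r|%:C.
Proof. by rewrite normc_def/= expr0n addr0 sqrtr_sqr. Qed.

Lemma norm_sublinear : sublinear (fun x => complex.Re `|x|).
Proof.
split=> [|r x r0]; first exact: Re_normD.
by rewrite Re_normZ normcR/= gtr0_norm.
Qed.

(** An additive minorant [q] of the norm shifted at [y] is bounded by the norm and satisfies
    [q y >= |y| > 0]; it is the real part of the functional sought. *)
Lemma continuous_functional_neq0 y : y != 0 ->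
  exists2 F : {linear V -> R[i]^o}, continuous F & F y != 0.
Proof.
move=> yN0.
have [q [qD qZ qp]] := sublinear_minorant (shift_sublinear y norm_sublinear).
have qN x : q (- x) = - q x.
  by have := qZ (-1) x; rewrite rmorphN rmorph1 scaleN1r mulN1r.
have q_le x : `|q x| <= complex.Re `|x|.
  have q_le1 z : q z <= complex.Re `|z|.
    exact: le_trans (qp z) (shift_le_id y z norm_sublinear).
  by rewrite ler_norml lerNl -qN q_le1 andbT -normrN q_le1.
(* The usual complexification of a real-linear functional, for which [F ('i x) = 'i F x]. *)
pose F x : R[i]^o := q x +i* - q ('i *: x).
have linF : linear F.
  move=> a x z; rewrite /F.
  have aE v : a *: v = (complex.Re a)%:C *: v + (complex.Im a)%:C *: ('i *: v).
    by rewrite [in LHS](complexE a) scalerDl scalerA mulrC.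
  have iiE v : 'i *: ('i *: v) = - v :> V.
    by rewrite scalerA -expr2 sqr_i scaleN1r.
  rewrite scalerDr scalerA [in 'i * a]mulrC -scalerA !qD !aE !qD !qZ iiE qN.
  case: a {aE} => c e /=.
  by apply/eqP; rewrite eq_complex /=; apply/andP; split; apply/eqP; ring.
pose L : {linear V -> R[i]^o} :=
  HB.pack F (GRing.isLinear.Build _ _ _ _ _ linF).
exists L.
  apply: bounded_linear_continuous; apply/bounded_funP => r.
  exists (r + r) => x xr; rewrite /L/= /F [X in `|X|](complexE (q x -i* q ('i *: x)))/=.
  apply: le_trans (ler_normD _ _) _; rewrite normrM !normcR.
  have -> : `|'i| = 1 :> R[i].
    by rewrite normc_def/= expr0n expr1n add0r sqrtr1.
  rewrite mul1r normrN; apply: lerD; apply: le_trans xr; rewrite -Re_normK lecR//.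
  rewrite -[leRHS]mul1r (le_trans (q_le _))// Re_normZ.
  by rewrite normc_def/= expr0n expr1n add0r sqrtr1.
rewrite /L/= /F eq_complex/= negb_and gt_eqF//.
have := le_trans (qp (- y)) (shift_le_subr y (- y) norm_sublinear).
rewrite addNr normr0 qN/= add0r lerN2; apply: lt_le_trans.
by rewrite Re_norm_gt0.
Qed.

End real_norm.

Section opnorm.
Variables (R : realType) (X Y : normedModType R[i]).
Implicit Types f : X -> Y.

Lemma opnorm_le f (M : R) :
  (forall x, `|x| <= 1 -> complex.Re `|f x| <= M) -> (opnorm f <= M%:E)%E.
Proof. by move=> h; apply: ge_ereal_sup => _ [x /= /h ? <-]; rewrite lee_fin. Qed.

Lemma le_opnorm f x : `|x| <= 1 -> ((complex.Re `|f x|)%:E <= opnorm f)%E.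
Proof. by move=> x1; apply: ereal_sup_ubound; exists x. Qed.

Lemma opnorm_lt_norm f x (M : R) : `|x| <= 1 -> (opnorm f < M%:E)%E ->
  complex.Re `|f x| < M.
Proof. by rewrite -lte_fin => /(le_opnorm f); exact: le_lt_trans. Qed.

End opnorm.

(** * Compactness of rank-one operators *)

Section rank_one.
Variables (R : realType) (X Y : normedModType R[i]).

Lemma real_complex_continuous : continuous (real_complex R : R -> R[i]^o).
Proof.
move=> a; apply/cvgrPdist_lt => e e0.
have eE : e = (complex.Re e)%:C by rewrite RRe_real// gtr0_real.
have e0' : 0 < complex.Re e by rewrite -ltcR -eE.
near=> b; rewrite -rmorphB/= normcR eE ltcR.
by near: b; apply: cvgr_dist_lt => //; exact: cvg_id.
Unshelve. all: by end_near. Qed.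

Lemma rank_one_precompact (fs : {linear X -> R[i]^o}) (y : Y) :
  continuous fs -> precompact [set fs x *: y | x in [set x : X | `|x| <= 1]].
Proof.
move=> /linear_lipschitz[k k0 fsk].
pose M := complex.Re k.
have kE : k = M%:C by rewrite RRe_real// gtr0_real.
(* Multiplication of [y] by a complex scalar in real coordinates: the image of the unit ball lies in
   the image of a compact real square. *)
pose g (u : R * R) : Y := u.1%:C *: y + u.2%:C *: ('i *: y).
have cg : continuous g.
  move=> u; apply: cvgD; apply: cvgZr_tmp;
    apply: (@continuous_comp _ _ R[i]^o _ (real_complex R));
    [exact: cvg_fst| |exact: cvg_snd|]; exact: real_complex_continuous.
have cK : compact [set g u | u in `[- M, M] `*` `[- M, M]].
  apply: continuous_compact; first exact: continuous_subspaceT.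
  by apply: compact_setX; exact: segment_compact.
apply: precompact_subset (compact_precompact (@norm_hausdorff _ _) cK).
move=> _ [x /= x1 <-].
have : `|fs x| <= M%:C.
  by rewrite -kE (le_trans (fsk x))// -[leRHS]mulr1 ler_wpM2l// ltW.
case: (fs x) => a b; rewrite normc_def/= lecR => abM.
exists (a, b); last first.
  by rewrite /g/= [in RHS](complexE (a +i* b))/= scalerDl scalerA [_ * 'i]mulrC.
split; rewrite /= in_itv/= -ler_norml; apply: le_trans abM;
  by rewrite -sqrtr_sqr ler_sqrt ?addr_ge0 ?sqr_ge0// ?lerDl ?lerDr sqr_ge0.
Qed.

End rank_one.

(** * The two implications *)

Section compact_operators.
Variables (R : realType) (d : measure_display) (T : measurableType d).
Variables (mu : {measure set T -> \bar R}) (X Y : completeNormedModType R[i]).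
Variable Delta : set T -> X -> X.

Lemma compact_ac_dual_ac : (exists y : Y, y != 0) ->
  (forall S : {linear X -> Y}, compact_operators X Y S ->
     absolutely_continuous_operator mu Delta S) ->
  dual_absolutely_continuous mu Delta.
Proof.
move=> [y yN0] acK fs cfs e e0.
have linS : linear (fun x => fs x *: y).
  by move=> a u v; rewrite linearP scalerDl scalerA.
pose S : {linear X -> Y} := HB.pack (fun x : X => fs x *: y)
  (GRing.isLinear.Build _ _ _ _ _ linS).
have cS : compact_operators X Y S.
  split; last exact: rank_one_precompact.
  by move=> x; apply: cvgZr_tmp; exact: cfs.
have y0 : 0 < complex.Re `|y| by rewrite Re_norm_gt0.
(* Pointwise bounds pass to the supremum only as a weak inequality; halving keeps it strictly below
   [e]. *)
have e2 : 0 < e / 2 by lra.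
have [delta delta0 acS] := acK S cS _ (mulr_gt0 e2 y0).
exists delta => // A mA muA; apply: (@le_lt_trans _ _ (e / 2)%:E); last first.
  by rewrite lte_fin; lra.
apply: opnorm_le => x x1; have := opnorm_lt_norm x1 (acS A mA muA).
by rewrite /S/= Re_normZ ltr_pM2r// => /ltW.
Qed.

Lemma dual_ac_compact_ac : wide_function_space mu Delta ->
  dual_absolutely_continuous mu Delta ->
  forall S : {linear X -> Y}, compact_operators X Y S ->
    absolutely_continuous_operator mu Delta S.
Proof.
move=> hX acX S [cS]; rewrite precompactE => cK e e0.
apply: contrapT => noDelta.
have /choice[Ax AxP] (n : nat) : exists Ax : set T * X,
    [/\ measurable Ax.1, (mu Ax.1 < (n.+1%:R^-1)%:E)%E, `|Ax.2| <= 1 &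
        e / 2 < complex.Re `|S (Delta Ax.1 Ax.2)|].
  apply: contrapT => noAx; apply: noDelta; exists n.+1%:R^-1 => // A mA muA.
  apply: (@le_lt_trans _ _ (e / 2)%:E); last by rewrite lte_fin; lra.
  apply: opnorm_le => x x1; rewrite leNgt; apply/negP => ex.
  by apply: noAx; exists (A, x).
have [C [C0 DC]] := wfs_bounded hX.
(* Dividing by [C] brings the vectors back to the unit ball, where compactness of [S] applies. *)
pose w n := C^-1%:C *: Delta (Ax n).1 (Ax n).2.
have w1 n : `|w n| <= 1.
  have [mA _ x1 _] := AxP n.
  rewrite /w normrZ normcR gtr0_norm ?invr_gt0// fmorphV/=.
  rewrite ler_pdivrMl ?ltcR// mulr1 (le_trans (DC _ _ mA))//.
  by rewrite -[leRHS]mulr1 ler_wpM2l// ler0c ltW.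
have ReZ (Z : normedModType R[i]) (G : {linear X -> Z}) n :
    complex.Re `|G (w n)| =
    C^-1 * complex.Re `|G (Delta (Ax n).1 (Ax n).2)|.
  by rewrite /w linearZ/= Re_normZ normcR/= gtr0_norm ?invr_gt0.
have [|p [_ clp]] := cK ((S \o w) @ \oo) _.
  by exists 0%N => // n _; apply: subset_closure; exists (w n) => /=; first exact: w1.
(* Every neighbourhood of [p] is visited at arbitrarily large indices. *)
have clpP (N : nat) (U : set Y) : nbhs p U ->
    exists2 n, (N <= n)%N & U (S (w n)).
  move=> pU; pose tail := [set S (w n) | n in [set n | (N <= n)%N]].
  have [|_ [[n Nn <-] Un]] := clp tail U _ pU.
    by exists N => // n Nn; exists n.
  by exists n.
have pN0 : p != 0.
  (* Every [S (w n)] has norm above [c], so none lies in the ball of radius [c] around 0. *)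
  apply/eqP => p0; pose c := C^-1 * (e / 2).
  have c0 : 0 < c by rewrite mulr_gt0 ?invr_gt0//; lra.
  have [|n _] := clpP 0%N [set v | `|p - v| < c%:C].
    by apply: cvgr_dist_lt; [exact: cvg_id|rewrite ltcR].
  rewrite /= p0 sub0r normrN -Re_normK ltcR ReZ ltr_pM2l ?invr_gt0//.
  by have [_ _ _ /ltW] := AxP n; rewrite leNgt => /negP.
have [F cF FpN0] := continuous_functional_neq0 pN0.
have linFS : linear (F \o S) by move=> a u v /=; rewrite !linearP.
pose FS : {linear X -> R[i]^o} := HB.pack (F \o S)
  (GRing.isLinear.Build _ _ _ _ _ linFS).
have cFS : dual X FS by move=> x; apply: continuous_comp; [exact: cS|exact: cF].
pose a := complex.Re `|F p|.
have a0 : 0 < a by rewrite Re_norm_gt0.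
(* The factor [C] offsets the [C^-1] in [w], giving [|FS (w n)| < a / 2] for large [n]. An index
   where also [|F p - FS (w n)| < a / 2] then contradicts [|F p| = a]. *)
have Ca0 : 0 < C * (a / 2) by rewrite mulr_gt0//; lra.
have [delta delta0 acFS] := acX FS cFS _ Ca0.
have [N _ Ndelta] : \forall n \near \oo, n.+1%:R^-1 < delta.
  exact: near_infty_natSinv_lt (PosNum delta0).
have [|n Nn near_p] := clpP N [set v | `|F p - F v| < (a / 2)%:C].
  by apply: (cvgr_dist_lt _ _ (cF p)); rewrite ltcR; lra.
have [mA muA x1 _] := AxP n.
have muA_lt : (mu (Ax n).1 < delta%:E)%E.
  by apply: lt_trans muA _; rewrite lte_fin Ndelta.
have small : complex.Re `|FS (w n)| < a / 2.
  by rewrite ReZ ltr_pdivrMl//; exact: opnorm_lt_norm x1 (acFS _ mA muA_lt).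
have close : complex.Re `|F p - FS (w n)| < a / 2.
  by rewrite -ltcR Re_normK.
have := Re_normD (F p - FS (w n)) (FS (w n)); rewrite subrK -/a; lra.
Qed.

End compact_operators.

Theorem mainTheorem4 (R : realType) (d : measure_display)
  (T : measurableType d) (mu : {measure set T -> \bar R})
  (X Y : completeNormedModType R[i]) (Delta : set T -> X -> X)
  (hX : wide_function_space mu Delta) (hY : exists y : Y, y != 0) :
  (forall S : {linear X -> Y}, compact_operators X Y S ->
     absolutely_continuous_operator mu Delta S) <->
  dual_absolutely_continuous mu Delta.
Proof.
split; first exact: compact_ac_dual_ac.
exact: dual_ac_compact_ac.
Qed.
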